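(* Let $G$ be a connected graph with $n$ vertices. Then $$MS_1(G)\ \ge\ 4(n-1)W(G)-MS^{1}(G),$$ with equality if and only if $\mathrm{diam}(G)\le 2$.
   Context: All graphs are finite and simple. $d(u)$ is the degree of a vertex $u$; $d(u,v)$ is the graph distance; the transmission of $v$ is $\sigma(v)=\sum_{u\in V(G)}d(v,u)$; $\mathrm{diam}(G)$ is the maximum distance between two vertices. The first transmission Zagreb index is $MS_1(G)=\sum_{uv\in E(G)}(\sigma(u)+\sigma(v))=\sum_{u\in V(G)}d(u)\sigma(u)$; the Wiener index is $W(G)=\frac12\sum_{u\in V(G)}\sigma(u)$; and $MS^{1}(G)=\sum_{u\in V(G)}\sigma(u)^2$ (superscript 1 is an index parameter; this is different from $MS_1$). *)

(* Defs.v *)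
(* Library: Mathematical Components. *)
From mathcomp Require Import all_boot all_order all_algebra.

Set Implicit Arguments.
Unset Strict Implicit.
Unset Printing Implicit Defensive.

Import GRing.Theory Num.Theory.

(* A finite simple graph is a symmetric irreflexive relation on a finType. *)
Definition simple_graph (T : finType) (e : rel T) : Prop :=
  symmetric e /\ irreflexive e.

Definition connected_graph (T : finType) (e : rel T) : Prop :=
  0 < #|T| /\ forall x y : T, connect e x y.

Definition edges (T : finType) (e : rel T) : {set {set T}} :=
  [set [set p.1; p.2] | p : T * T & e p.1 p.2].

Definition has_walk (T : finType) (e : rel T) (x y : T) (k : nat) : bool :=
  [exists p : k.-tuple T, path e x p && (last x p == y)].

(* The least length of a walk from x to y. A shortest walk has fewer than #|T|
   steps, so the search over 0, ..., #|T| - 1 finds it whenever x and y are in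
   the same component; otherwise the value is #|T|, by convention. *)
Definition gdist (T : finType) (e : rel T) (x y : T) : nat :=
  find (has_walk e x y) (iota 0 #|T|).

Definition diam (T : finType) (e : rel T) : nat :=
  \max_(x : T) \max_(y : T) gdist e x y.

Definition transmission (T : finType) (e : rel T) (v : T) : nat :=
  \sum_(u : T) gdist e v u.

(* MS_1. An edge is the set E = {u, v} of its two distinct endpoints, so the
   inner sum is sigma(u) + sigma(v). *)
Definition MS_1 (T : finType) (e : rel T) : nat :=
  \sum_(E in edges e) \sum_(u in E) transmission e u.

Definition Wiener (T : finType) (e : rel T) : rat :=
  (2^-1 * (\sum_(u : T) transmission e u)%N%:R)%R.

(* MS^1 with a superscript index, not to be confused with MS_1. *)
Definition MS_sup1 (T : finType) (e : rel T) : nat :=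
  \sum_(u : T) transmission e u ^ 2.

(* Main.v *)
Require Import Defs.
From mathcomp Require Import all_boot all_order all_algebra.

Import GRing.Theory Num.Theory.

(** Write [N = n - 1] and let [sigma u] be the transmission of [u]. Every vertex
    other than [u] is at distance [1] from [u] if it is a neighbour, and at
    distance at least [2] if it is not, so [2 * N <= d(u) + sigma u], with
    equality exactly when no vertex is farther than [2] from [u]. Multiply by
    [sigma u] and sum over [u]: the left-hand side becomes
    [2 * N * (2 * W) = 4 * N * W], and the right-hand side [MS_1 + MS^1] by double
    counting of the incident pairs (vertex, edge) ([MS_1_degree]).

    Multiplying by [sigma u] loses no equality case: [sigma u = 0] forces all
    the distances from [u] to vanish, in particular to be at most [2]. Hence
    equality in the sum means that all distances are at most [2].

    The proof carries the equality conditions along with the inequalities, as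
    conditional inequalities [_ <= _ ?= iff _] on [nat] ([two_le_gdist_edge],
    [two_le_degree_transmission], [wiener_le_MS]); only the last step moves to
    the rationals. *)

Section Graph.

Variables (T : finType) (e : rel T).
Hypothesis simple_e : simple_graph e.

Local Notation sigma := (transmission e).

Lemma has_walk0 (x y : T) : has_walk e x y 0 = (x == y).
Proof.
apply/existsP/idP => [[p]|/eqP ->]; first by rewrite tuple0.
by exists [tuple]; rewrite /= eqxx.
Qed.

Lemma has_walk1 (x y : T) : has_walk e x y 1 = e x y.
Proof.
apply/existsP/idP => [[p]|exy]; last by exists [tuple y]; rewrite /= exy eqxx.
by case/tupleP: p => z p; rewrite tuple0 /= andbT => /andP[exz /eqP <-].
Qed.

Lemma gdist_xx (x : T) : gdist e x x = 0.
Proof.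
have: 0 < #|T| by apply/card_gt0P; exists x.
by rewrite /gdist; case: #|T| => [//|m] _ /=; rewrite has_walk0 eqxx.
Qed.

(** For [y] adjacent to [x] the edge makes up for the unit by which the distance
    falls short of [2]; for other [y], distinct from [x], the distance alone is
    at least [2], and the excess over [2] is the defect. *)
Lemma two_le_gdist_edge (x y : T) :
  2 * (x != y) <= gdist e x y + e x y ?= iff (gdist e x y <= 2).
Proof.
have [_ irr_e] := simple_e.
have [<-|neq_xy] := eqVneq x y.
  by rewrite gdist_xx irr_e; apply/leqif_refl.
(* Two distinct vertices: the search for the distance covers 0 and 1. *)
have: 1 < #|T| by rewrite -cardsT; apply/card_gt1P; exists x, y.
rewrite /gdist; case: #|T| => [|[|m]] // _ /=.
rewrite has_walk0 has_walk1 (negPf neq_xy).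
case: (e x y); first exact/leqif_refl.
by rewrite addn0; split=> //; rewrite !eqSS !ltnS leqn0 eq_sym.
Qed.

(** The sum of [two_le_gdist_edge] over [y]; it is tight when every term is. *)
Lemma two_le_degree_transmission (x : T) :
  2 * #|T|.-1 <= sigma x + #|[set y | e x y]|
    ?= iff [forall y, gdist e x y <= 2].
Proof.
have := leqif_sum (fun y (_ : true) => two_le_gdist_edge x y).
rewrite -big_distrr big_split /= -big_mkcond /= sum1_card -(cardC1 x).
rewrite -[\sum_y e x y]big_mkcond /= sum1_card cardsE.
by rewrite (eq_card (B := predC1 x)) // => y; rewrite !inE eq_sym.
Qed.

Lemma edges_at (x : T) :
  [set E in edges e | x \in E] = [set [set x; y] | y in [set y | e x y]].
Proof.
have [sym_e _] := simple_e.
apply/setP=> E; rewrite inE; apply/andP/imsetP => [[]|[y]].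
  case/imsetP=> -[u v]; rewrite inE /= => euv ->.
  rewrite !inE => /orP[]/eqP->; first by exists v; rewrite ?inE.
  by exists u; rewrite ?inE 1?sym_e // setUC.
rewrite inE => exy ->; split; last by rewrite set21.
by apply/imsetP; exists (x, y); rewrite ?inE.
Qed.

Lemma card_edges_at (x : T) :
  #|[set E in edges e | x \in E]| = #|[set y | e x y]|.
Proof.
have [_ irr_e] := simple_e.
rewrite edges_at card_in_imset // => y z; rewrite !inE => exy exz eq_yz.
have: y \in [set x; z] by rewrite -eq_yz set22.
by rewrite !inE => /orP[]/eqP// yx; rewrite yx irr_e in exy.
Qed.

(** Double counting: a vertex contributes its transmission once for each edge
    through it, and edges through a vertex correspond to its neighbours. *)
Lemma MS_1_degree : MS_1 e = \sum_x #|[set y | e x y]| * sigma x.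
Proof.
rewrite /MS_1 (exchange_big_dep xpredT) //=; apply: eq_bigr => x _.
by rewrite sum_nat_const -card_edges_at cardsE.
Qed.

Lemma diam_leP (k : nat) :
  (diam e <= k) = [forall x, forall y, gdist e x y <= k].
Proof.
apply/bigmax_leqP/forallP => [le_k x|le_k x _].
  by apply/forallP=> y; have /bigmax_leqP := le_k x isT; apply.
by apply/bigmax_leqP => y _; have /forallP := le_k x.
Qed.

(** The inequalities [two_le_degree_transmission], each weighted by the
    transmission of its vertex, add up to this one; it is tight when every
    weighted term is, which for a positive weight means that the vertex has no
    other vertex beyond distance [2]. *)
Lemma wiener_le_MS :
  2 * #|T|.-1 * (\sum_x sigma x) <= MS_1 e + MS_sup1 e ?= iff (diam e <= 2).
Proof.
rewrite MS_1_degree /MS_sup1 -big_split big_distrr diam_leP /=.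
apply: leqif_sum => x _.
have -> : #|[set y | e x y]| * sigma x + sigma x ^ 2
          = (sigma x + #|[set y | e x y]|) * sigma x.
  by rewrite mulnDl addnC mulnn.
have [le_x eq_x] := two_le_degree_transmission x.
split; first by rewrite leq_mul2r le_x orbT.
rewrite eqn_mul2r eq_x; apply/orb_idl.
(* Zero weight: the distances from x add up to 0, so they all vanish. *)
rewrite sum_nat_eq0 => /forallP sigma0.
by apply/forallP=> y; rewrite (eqP (sigma0 y)).
Qed.

End Graph.

Local Open Scope ring_scope.

Theorem proposition2 (T : finType) (e : rel T) (n : nat)
    (simple_e : simple_graph e) (connected_e : connected_graph e)
    (card_T : #|T| = n) :
  (MS_1 e)%:R >= 4 * (n%:R - 1) * Wiener e - (MS_sup1 e)%:R :> rat
  /\ ((MS_1 e)%:R = 4 * (n%:R - 1) * Wiener e - (MS_sup1 e)%:R :> rat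
      <-> (diam e <= 2)%N).
Proof.
have [n_gt0 _] := connected_e.
have [le_MS eq_MS] := wiener_le_MS _ _ simple_e.
have -> : 4 * (n%:R - 1) * Wiener e
          = (2 * #|T|.-1 * (\sum_x transmission e x))%N%:R :> rat.
  rewrite -card_T -subn1 !natrM natrB // /Wiener.
  by rewrite mulrACA mulrA (_ : 4 / 2 = 2).
rewrite lerBlDr -natrD ler_nat; split=> //.
split=> [eqR|/[!(esym eq_MS)]/eqP ->]; last by rewrite natrD addrK.
by rewrite -eq_MS -(eqr_nat rat) natrD eqR subrK.
Qed.
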